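(* Let $\mathbf{k}$ be an infinite field, let $\mathcal{C}$ be a $\mathbf{k}$-linear, Hom-finite, 2-Calabi--Yau triangulated category that admits a dg enhancement, and let $\tau$ be a Bridgeland stability condition on $\mathcal{C}$ in which every $\tau$-semistable spherical object is $\tau$-stable. Let $X$ be a spherical object with $\tau$-Harder--Narasimhan filtration $$0\to X_0\to X_1\to\cdots\to X_n=X$$ with factors $A_0,\dots,A_n$ (in this order). Let $W$ be another spherical object with $\tau$-Harder--Narasimhan filtration $$0\to W_0\to W_1\to\cdots\to W_n=W$$ which also has factors $A_0,\dots,A_n$ (in the same order). Then $X\cong W$.
   Context: 2-Calabi--Yau means that there are functorial isomorphisms $\operatorname{Hom}(X,Y)\cong\operatorname{Hom}(Y,X[2])^{*}$. A spherical object is an object $X$ with $\operatorname{Hom}(X,X[j])\cong\mathbf{k}$ for $j\in\{0,2\}$ and $0$ otherwise. The factors of a filtration $0\to X_0\to\cdots\to X_n=X$ are the objects $A_i$ completing the triangles $X_{i-1}\to X_i\to A_i\xrightarrow{+1}$, with $X_{-1}=0$ (so $A_0=X_0$). In a Harder--Narasimhan filtration the factors are nonzero $\tau$-semistable objects of strictly decreasing phase. An object of the abelian category of semistable objects of phase $\phi$ is stable if it is simple in that category. *)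

(* Defs.v *)
From HB Require Import structures.
From mathcomp Require Import all_boot all_order all_algebra.
From mathcomp Require Import all_classical all_reals all_analysis.
From mathcomp Require Import complex.

Set Implicit Arguments.
Unset Strict Implicit.
Unset Printing Implicit Defensive.

Import Order.TTheory GRing.Theory Num.Theory.
Local Open Scope ring_scope.
Local Open Scope complex_scope.

Reserved Notation "g \c f" (at level 40, left associativity).
Reserved Notation "g \d f" (at level 40, left associativity).

(* A [vectType k] is a finite-dimensional vector space, so Hom-finiteness is
   part of the structure. *)
Record hfcat (k : fieldType) := HfCat {
  obj :> Type;
  hom : obj -> obj -> vectType k;
  comp : forall X Y Z : obj, hom Y Z -> hom X Y -> hom X Z;
  idm : forall X : obj, hom X X;
  comp_linl : forall (X Y Z : obj) (a : k) (g g' : hom Y Z) (f : hom X Y),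
    comp (a *: g + g') f = a *: comp g f + comp g' f;
  comp_linr : forall (X Y Z : obj) (a : k) (g : hom Y Z) (f f' : hom X Y),
    comp g (a *: f + f') = a *: comp g f + comp g f';
  compA : forall (X Y Z W : obj) (h : hom Z W) (g : hom Y Z) (f : hom X Y),
    comp h (comp g f) = comp (comp h g) f;
  comp1m : forall (X Y : obj) (f : hom X Y), comp (idm Y) f = f;
  compm1 : forall (X Y : obj) (f : hom X Y), comp f (idm X) = f }.

Arguments hom {k C} X Y : rename.
Arguments comp {k C X Y Z} g f : rename.
Arguments idm {k C} X : rename.
Notation "g \c f" := (comp g f) : ring_scope.

Definition is_iso (k : fieldType) (C : hfcat k) (X Y : C) (f : hom X Y) : Prop :=
  exists g : hom Y X, g \c f = idm X /\ f \c g = idm Y.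

Definition iso (k : fieldType) (C : hfcat k) (X Y : C) : Prop :=
  exists f : hom X Y, is_iso f.

Definition is_zero (k : fieldType) (C : hfcat k) (X : C) : Prop :=
  (forall (Y : C) (f : hom X Y), f = 0) /\ (forall (Y : C) (f : hom Y X), f = 0).

Definition is_biproduct (k : fieldType) (C : hfcat k) (X Y B : C) : Prop :=
  exists (iX : hom X B) (iY : hom Y B) (pX : hom B X) (pY : hom B Y),
    [/\ pX \c iX = idm X, pY \c iY = idm Y, pX \c iY = 0, pY \c iX = 0
      & iX \c pX + iY \c pY = idm B].

Record lfunctor (k : fieldType) (C D : hfcat k) := LFunctor {
  fobj :> C -> D;
  fmap : forall X Y : C, hom X Y -> hom (fobj X) (fobj Y);
  fmap_lin : forall (X Y : C) (a : k) (f g : hom X Y),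
    fmap (a *: f + g) = a *: fmap f + fmap g;
  fmap_id : forall X : C, fmap (idm X) = idm (fobj X);
  fmap_comp : forall (X Y Z : C) (g : hom Y Z) (f : hom X Y),
    fmap (g \c f) = fmap g \c fmap f }.

Arguments fmap {k C D} F {X Y} f : rename.

(* The shift is an autoequivalence, with a chosen quasi-inverse [tshiftV];
   [tri f g h] says that X -f-> Y -g-> Z -h-> X[1] is distinguished.  Verdier's axioms are TR1 =
   [tri_iso], [tri_id], [tri_cone]; TR2 = [tri_rot]; TR3 = [tri_mor]; TR4 =
   [tri_oct]. *)
Record tricat (k : fieldType) := TriCat {
  tcat :> hfcat k;
  tshift : lfunctor tcat tcat;
  tshiftV : lfunctor tcat tcat;
  tshift_unit : forall X : tcat, hom X (tshiftV (tshift X));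
  tshift_unit_iso : forall X : tcat, is_iso (tshift_unit X);
  tshift_unit_nat : forall (X Y : tcat) (f : hom X Y),
    fmap tshiftV (fmap tshift f) \c tshift_unit X = tshift_unit Y \c f;
  tshift_counit : forall X : tcat, hom (tshift (tshiftV X)) X;
  tshift_counit_iso : forall X : tcat, is_iso (tshift_counit X);
  tshift_counit_nat : forall (X Y : tcat) (f : hom X Y),
    tshift_counit Y \c fmap tshift (fmap tshiftV f) = f \c tshift_counit X;
  zero_exists : exists O : tcat, is_zero O;
  biproduct_exists : forall X Y : tcat, exists B : tcat, is_biproduct X Y B;
  tri : forall X Y Z : tcat,
    hom X Y -> hom Y Z -> hom Z (tshift X) -> Prop;
  tri_iso : forall (X Y Z X' Y' Z' : tcat)
    (f : hom X Y) (g : hom Y Z) (h : hom Z (tshift X))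
    (f' : hom X' Y') (g' : hom Y' Z') (h' : hom Z' (tshift X'))
    (u : hom X X') (v : hom Y Y') (w : hom Z Z'),
    is_iso u -> is_iso v -> is_iso w ->
    v \c f = f' \c u -> w \c g = g' \c v -> fmap tshift u \c h = h' \c w ->
    tri f g h -> tri f' g' h';
  tri_id : forall X O : tcat, is_zero O ->
    tri (idm X) (0 : hom X O) (0 : hom O (tshift X));
  tri_cone : forall (X Y : tcat) (f : hom X Y),
    exists (Z : tcat) (g : hom Y Z) (h : hom Z (tshift X)), tri f g h;
  tri_rot : forall (X Y Z : tcat)
    (f : hom X Y) (g : hom Y Z) (h : hom Z (tshift X)),
    tri f g h <-> tri g h (- fmap tshift f);
  tri_mor : forall (X Y Z X' Y' Z' : tcat)
    (f : hom X Y) (g : hom Y Z) (h : hom Z (tshift X))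
    (f' : hom X' Y') (g' : hom Y' Z') (h' : hom Z' (tshift X'))
    (u : hom X X') (v : hom Y Y'),
    tri f g h -> tri f' g' h' -> v \c f = f' \c u ->
    exists w : hom Z Z', w \c g = g' \c v /\ fmap tshift u \c h = h' \c w;
  tri_oct : forall (X Y Z U V W : tcat) (f : hom X Y) (g : hom Y Z)
    (f1 : hom Y U) (f2 : hom U (tshift X))
    (g1 : hom Z V) (g2 : hom V (tshift Y))
    (h1 : hom Z W) (h2 : hom W (tshift X)),
    tri f f1 f2 -> tri g g1 g2 -> tri (g \c f) h1 h2 ->
    exists (a : hom U W) (b : hom W V),
      [/\ tri a b (fmap tshift f1 \c g2),
          a \c f1 = h1 \c g, h2 \c a = f2,
          b \c h1 = g1 & g2 \c b = fmap tshift f \c h2] }.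

Arguments tri {k C X Y Z} f g h : rename.

Definition shiftz (k : fieldType) (C : tricat k) (X : C) (j : int) : C :=
  match j with
  | Posz n => iter n (tshift C) X
  | Negz n => iter n.+1 (tshiftV C) X
  end.

(* kappa X Y : Hom(X, Y) -> Hom(Y, X[2])^* *)
Definition is_2CY (k : fieldType) (C : tricat k) : Prop :=
  exists kappa : forall X Y : C, hom X Y -> 'Hom(hom Y (shiftz X 2%:Z), k^o),
  [/\ forall (X Y : C) (a : k) (f g : hom X Y),
        kappa X Y (a *: f + g) = a *: kappa X Y f + kappa X Y g,
      forall X Y : C, bijective (kappa X Y),
      forall (X Y Y' : C) (v : hom Y Y') (f : hom X Y) (g : hom Y' (shiftz X 2%:Z)),
        kappa X Y' (v \c f) g = kappa X Y f (g \c v)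
    & forall (X X' Y : C) (u : hom X' X) (f : hom X Y) (g : hom Y (shiftz X' 2%:Z)),
        kappa X' Y (f \c u) g
          = kappa X Y f (fmap (tshift C) (fmap (tshift C) u) \c g)].

Definition spherical (k : fieldType) (C : tricat k) (X : C) : Prop :=
  forall j : int,
    \dim {: hom X (shiftz X j)} = (if (j == 0) || (j == 2) then 1 else 0)%N.

(* Hom complexes are cohomologically graded, and the graded vector space is
   encoded as its total space (the direct sum of its graded pieces) with
   [dgdeg n f] meaning that f is homogeneous of degree n; this avoids
   transporting composites along equalities of degrees. *)
Record dgcat (k : fieldType) := DgCat {
  dgobj :> Type;
  dghom : dgobj -> dgobj -> lmodType k;
  dgdeg : forall X Y : dgobj, int -> dghom X Y -> Prop;
  dgdeg0 : forall (X Y : dgobj) (n : int), dgdeg n (0 : dghom X Y);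
  dgdeg_lin : forall (X Y : dgobj) (n : int) (a : k) (f g : dghom X Y),
    dgdeg n f -> dgdeg n g -> dgdeg n (a *: f + g);
  dgdeg_span : forall (X Y : dgobj) (f : dghom X Y),
    exists (s : seq int) (c : int -> dghom X Y),
      (forall n : int, dgdeg n (c n)) /\ f = \sum_(n <- s) c n;
  dgdeg_free : forall (X Y : dgobj) (s : seq int) (c : int -> dghom X Y),
    uniq s -> (forall n : int, dgdeg n (c n)) -> \sum_(n <- s) c n = 0 ->
    forall n : int, n \in s -> c n = 0;
  dgd : forall X Y : dgobj, dghom X Y -> dghom X Y;
  dgd_lin : forall (X Y : dgobj) (a : k) (f g : dghom X Y),
    dgd (a *: f + g) = a *: dgd f + dgd g;
  dgd_deg : forall (X Y : dgobj) (n : int) (f : dghom X Y),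
    dgdeg n f -> dgdeg (n + 1) (dgd f);
  dgdd : forall (X Y : dgobj) (f : dghom X Y), dgd (dgd f) = 0;
  dgcomp : forall X Y Z : dgobj, dghom Y Z -> dghom X Y -> dghom X Z;
  dgid : forall X : dgobj, dghom X X;
  dgcomp_linl : forall (X Y Z : dgobj) (a : k) (g g' : dghom Y Z) (f : dghom X Y),
    dgcomp (a *: g + g') f = a *: dgcomp g f + dgcomp g' f;
  dgcomp_linr : forall (X Y Z : dgobj) (a : k) (g : dghom Y Z) (f f' : dghom X Y),
    dgcomp g (a *: f + f') = a *: dgcomp g f + dgcomp g f';
  dgcompA : forall (X Y Z W : dgobj)
    (h : dghom Z W) (g : dghom Y Z) (f : dghom X Y),
    dgcomp h (dgcomp g f) = dgcomp (dgcomp h g) f;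
  dgcomp1m : forall (X Y : dgobj) (f : dghom X Y), dgcomp (dgid Y) f = f;
  dgcompm1 : forall (X Y : dgobj) (f : dghom X Y), dgcomp f (dgid X) = f;
  dgid_deg : forall X : dgobj, dgdeg 0 (dgid X);
  dgcomp_deg : forall (X Y Z : dgobj) (m n : int) (g : dghom Y Z) (f : dghom X Y),
    dgdeg m g -> dgdeg n f -> dgdeg (m + n) (dgcomp g f);
  dgd_comp : forall (X Y Z : dgobj) (m : int) (g : dghom Y Z) (f : dghom X Y),
    dgdeg m g ->
    dgd (dgcomp g f) = dgcomp (dgd g) f + (-1) ^ m *: dgcomp g (dgd f) }.

Arguments dghom {k A} X Y : rename.
Arguments dgdeg {k A X Y} n f : rename.
Arguments dgd {k A X Y} f : rename.
Arguments dgcomp {k A X Y Z} g f : rename.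
Arguments dgid {k A} X : rename.
Notation "g \d f" := (dgcomp g f) : ring_scope.

Definition cocycle (k : fieldType) (A : dgcat k) (n : int) (X Y : A)
  (f : dghom X Y) : Prop := dgdeg n f /\ dgd f = 0.

(* For cocycles f, g of degree n: equality of their classes in H^n Hom(X, Y). *)
Definition homotopic (k : fieldType) (A : dgcat k) (n : int) (X Y : A)
  (f g : dghom X Y) : Prop :=
  exists h : dghom X Y, dgdeg (n - 1) h /\ f - g = dgd h.

(* Y is homotopy equivalent to X[n]; s and t are mutually inverse homotopy
   equivalences X[n] -> Y and Y -> X[n], seen as morphisms between X and Y. *)
Definition is_dgshift (k : fieldType) (A : dgcat k) (n : int) (X Y : A)
  (s : dghom X Y) (t : dghom Y X) : Prop :=
  [/\ cocycle (- n) s, cocycle n t,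
      homotopic 0 (s \d t) (dgid Y) & homotopic 0 (t \d s) (dgid X)].

(* Z is homotopy equivalent to the cone of f : X -> Y.  As an object of the
   category of twisted complexes, Cone(f) is Y (+) X[1] with twisting f.  The
   matrices (i, j) : Cone(f) -> Z and (q, p)^T : Z -> Cone(f) are closed of
   degree 0 (second clause), and they are inverse to each other up to homotopy:
   [h] is a homotopy on Z, and the matrix [[a, b], [c, e]] is one on Cone(f).
   The terms in f of the last clause come from the twisted differential. *)
Definition is_dgcone (k : fieldType) (A : dgcat k) (X Y Z : A) (f : dghom X Y)
  (i : dghom Y Z) (j : dghom X Z) (p : dghom Z X) (q : dghom Z Y) : Prop :=
  [/\ [/\ dgdeg 0 i, dgdeg (-1) j, dgdeg 1 p & dgdeg 0 q],
      [/\ dgd i = 0, dgd j = i \d f, dgd p = 0 & dgd q = - (f \d p)],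
      homotopic 0 (i \d q + j \d p) (dgid Z)
    & exists (a : dghom Y Y) (b : dghom X Y) (c : dghom Y X) (e : dghom X X),
      [/\ dgdeg (-1) a, dgdeg (-2) b, dgdeg 0 c & dgdeg (-1) e] /\
      [/\ q \d i - dgid Y = dgd a + f \d c,
          q \d j = dgd b + a \d f + f \d e,
          p \d i = - dgd c
        & p \d j - dgid X = c \d f - dgd e]].

(* Shifts and cones of closed degree 0 morphisms exist up to homotopy
   equivalence (Bondal-Kapranov). *)
Definition pretriangulated (k : fieldType) (A : dgcat k) : Prop :=
  (forall (X : A) (n : int),
     exists (Y : A) (s : dghom X Y) (t : dghom Y X), is_dgshift n s t) /\
  (forall (X Y : A) (f : dghom X Y), cocycle 0 f ->
     exists (Z : A) (i : dghom Y Z) (j : dghom X Z) (p : dghom Z X)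
       (q : dghom Z Y), is_dgcone f i j p q).

(* An equivalence of triangulated categories H^0(A) -> C.  Morphisms X -> Y in
   H^0(A) are 0-cocycles modulo [homotopic 0], so [emap] only matters on
   0-cocycles.  In H^0(A), the shift functor is [esh] on objects and
   f |-> s f t on morphisms, and the distinguished triangles are the triangles
   isomorphic to X -f-> Y -i-> Z -(s p)-> X[1] with Z a cone of f.  Replacing
   [etheta] by its opposite changes the sign of s p, so the usual sign
   conventions all give the same notion. *)
Record enhancement (k : fieldType) (C : tricat k) (A : dgcat k) := Enhancement {
  enh_pretri : pretriangulated A;
  eobj : A -> C;
  emap : forall X Y : A, dghom X Y -> hom (eobj X) (eobj Y);
  emap_lin : forall (X Y : A) (a : k) (f g : dghom X Y),
    cocycle 0 f -> cocycle 0 g ->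
    emap (a *: f + g) = a *: emap f + emap g;
  emap_id : forall X : A, emap (dgid X) = idm (eobj X);
  emap_comp : forall (X Y Z : A) (g : dghom Y Z) (f : dghom X Y),
    cocycle 0 g -> cocycle 0 f -> emap (g \d f) = emap g \c emap f;
  emap_faithful : forall (X Y : A) (f g : dghom X Y),
    cocycle 0 f -> cocycle 0 g -> (emap f = emap g <-> homotopic 0 f g);
  emap_full : forall (X Y : A) (u : hom (eobj X) (eobj Y)),
    exists f : dghom X Y, cocycle 0 f /\ emap f = u;
  eobj_surj : forall E : C, exists X : A, iso (eobj X) E;
  esh : A -> A;
  es : forall X : A, dghom X (esh X);
  et : forall X : A, dghom (esh X) X;
  eshP : forall X : A, is_dgshift 1 (es X) (et X);
  etheta : forall X : A, hom (eobj (esh X)) (tshift C (eobj X));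
  etheta_iso : forall X : A, is_iso (etheta X);
  etheta_nat : forall (X Y : A) (f : dghom X Y), cocycle 0 f ->
    etheta Y \c emap (es Y \d f \d et X)
      = fmap (tshift C) (emap f) \c etheta X;
  emap_tri : forall (X Y Z : A) (f : dghom X Y) (i : dghom Y Z) (j : dghom X Z)
    (p : dghom Z X) (q : dghom Z Y),
    cocycle 0 f -> is_dgcone f i j p q ->
    tri (emap f) (emap i) (etheta X \c emap (es X \d p)) }.

Definition has_dg_enhancement (k : fieldType) (C : tricat k) : Prop :=
  exists A : dgcat k, inhabited (enhancement C A).

(* Fil i is X_(i-1) in the usual indexing, so that Fil 0 = X_(-1) = 0; A lists
   the factors and phi their phases. *)
Definition HN_filtration (R : realType) (k : fieldType) (C : tricat k)
  (P : R -> C -> Prop) (X : C) (n : nat) (A : 'I_n.+1 -> C) : Prop :=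
  exists (Fil : 'I_n.+2 -> C) (phi : 'I_n.+1 -> R),
  [/\ is_zero (Fil ord0), Fil ord_max = X,
      forall i : 'I_n.+1,
        exists (f : hom (Fil (widen_ord (leqnSn n.+1) i)) (Fil (lift ord0 i)))
          (g : hom (Fil (lift ord0 i)) (A i))
          (h : hom (A i) (tshift C (Fil (widen_ord (leqnSn n.+1) i)))),
          tri f g h,
      forall i : 'I_n.+1, P (phi i) (A i) /\ ~ is_zero (A i)
    & forall i j : 'I_n.+1, (i < j)%N -> phi j < phi i].

(* A homomorphism K_0(C) -> R[i] is the same as a function on objects that is
   additive on distinguished triangles.  [slice phi] is the full subcategory
   P(phi) of the slicing.  As in Bridgeland's original definition, neither local
   finiteness nor the support property is required. *)
Record stability_condition (R : realType) (k : fieldType) (C : tricat k) :=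
  StabilityCondition {
  charge : C -> R[i];
  charge_tri : forall (X Y Z : C)
    (f : hom X Y) (g : hom Y Z) (h : hom Z (tshift C X)),
    tri f g h -> charge Y = charge X + charge Z;
  slice : R -> C -> Prop;
  slice_iso : forall (phi : R) (X Y : C), iso X Y -> slice phi X -> slice phi Y;
  slice_zero : forall (phi : R) (O : C), is_zero O -> slice phi O;
  slice_biproduct : forall (phi : R) (X Y B : C),
    is_biproduct X Y B -> slice phi X -> slice phi Y -> slice phi B;
  slice_charge : forall (phi : R) (X : C), slice phi X -> ~ is_zero X ->
    exists m : R, 0 < m /\
      charge X = m%:C * (cos (pi * phi) +i* sin (pi * phi));
  slice_shift : forall (phi : R) (X : C),
    slice (phi + 1) X <-> exists Y : C, slice phi Y /\ iso X (tshift C Y);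
  slice_hom : forall (phi1 phi2 : R) (X Y : C), phi2 < phi1 ->
    slice phi1 X -> slice phi2 Y -> forall f : hom X Y, f = 0;
  slice_HN : forall X : C, ~ is_zero X ->
    exists (n : nat) (A : 'I_n.+1 -> C), HN_filtration slice X A }.

Definition semistable (R : realType) (k : fieldType) (C : tricat k)
  (tau : stability_condition R C) (phi : R) (X : C) : Prop :=
  slice tau phi X /\ ~ is_zero X.

(* Simplicity in the abelian category P(phi): every subobject, i.e. every
   monomorphism of P(phi) with target X, is zero or everything. *)
Definition stable (R : realType) (k : fieldType) (C : tricat k)
  (tau : stability_condition R C) (phi : R) (X : C) : Prop :=
  semistable tau phi X /\
  forall (Y : C) (f : hom Y X), slice tau phi Y ->
    (forall (T : C) (g h : hom T Y), slice tau phi T -> f \c g = f \c h -> g = h) ->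
    is_zero Y \/ is_iso f.

(* Main.v *)
From HB Require Import structures.
From mathcomp Require Import all_boot all_order all_algebra perm.
From mathcomp Require Import all_classical all_reals all_analysis.
Require Import Defs.

Set Implicit Arguments.
Unset Strict Implicit.
Unset Printing Implicit Defensive.

Import Order.TTheory GRing.Theory Num.Theory VectorInternalTheory.
Local Open Scope ring_scope.

(** Since [X] and [W] are spherical, they are rigid: [Hom(X, X[1]) = 0].  Their common
    factors [A_0, ..., A_n] satisfy [Hom(A_i, A_j) = 0] for [i < j], because phases
    decrease.

    Induct on the length of the filtration.  The last step is a triangle
    [Y -> X -> B -> Y[1]] with [B] the last factor, and [Hom(Y, B) = 0]
    ([hom_filtered_eq0]).  By a lemma of Mukai, which is where Serre duality enters, [Y]
    is again rigid ([mukai_rigid_sub]).  So, by induction, [X] and [W] are extensions of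
    [B] by the same object [Y], with classes [h] and [h'] in the finite-dimensional space
    [V = Hom(B, Y[1])], on which the group [G = Aut(Y[1]) x Aut(B)] acts.  Isomorphic
    objects arise from classes in the same orbit ([iso_cones]), so it suffices that [h]
    and [h'] lie in one orbit.

    Since [X] is rigid, the differential [(a, b) |-> a h - h b] of the orbit map at [h]
    is surjective ([rigid_extension_orbit]); geometrically, the orbit of [h] is open and
    dense in the affine space [V], so it meets the orbit of [h'].  To keep to points over
    [k], this is made explicit on the line [h_t = h + t (h' - h)].  The linear equation
    [a h = h_t b] has a solution [(a_t, b_t)] that is polynomial in [t] and equals
    [(1, 1)] at [t = 0] ([polycurve_kernel]).  The determinants of left composition with
    [a_t] and [b_t] are nonzero polynomials in [t], so [h_t] lies in the orbit of [h] for
    all but finitely many [t] ([generic_extension_iso]).  The same holds for [h'], and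
    since [k] is infinite some [h_t] lies in both orbits ([rigid_extension_unique]). *)

(** * Curves depending polynomially on a parameter *)

Definition polyfun (k : fieldType) (f : k -> k) : Prop :=
  exists p : {poly k}, forall t, f t = p.[t].

(** Testing against all linear forms avoids any choice of coordinates, and makes
    it obvious that linear maps preserve polynomial curves. *)
Definition polycurve (k : fieldType) (V : vectType k) (c : k -> V) : Prop :=
  forall l : V -> k, scalar l -> polyfun (l \o c).

Section PolynomialCurves.
Context {k : fieldType}.
Implicit Types (f g : k -> k) (V W : vectType k).

Lemma polyfun_cst a : polyfun (fun _ : k => a).
Proof. by exists a%:P => t; rewrite hornerC. Qed.

Lemma polyfun_id : polyfun (fun t : k => t).
Proof. by exists 'X => t; rewrite hornerX. Qed.

Lemma polyfunD f g : polyfun f -> polyfun g -> polyfun (fun t => f t + g t).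
Proof. by move=> [p Hp] [q Hq]; exists (p + q) => t; rewrite hornerD Hp Hq. Qed.

Lemma polyfunM f g : polyfun f -> polyfun g -> polyfun (fun t => f t * g t).
Proof. by move=> [p Hp] [q Hq]; exists (p * q) => t; rewrite hornerM Hp Hq. Qed.

Lemma polyfun_comp f g : polyfun f -> polyfun g -> polyfun (f \o g).
Proof.
by move=> [p Hp] [q Hq]; exists (p \Po q) => t; rewrite horner_comp /= Hp Hq.
Qed.

Lemma eq_polyfun f g : f =1 g -> polyfun g -> polyfun f.
Proof. by move=> fg [p Hp]; exists p => t; rewrite fg. Qed.

Lemma polyfun_sum (I : finType) (F : I -> k -> k) :
  (forall i, polyfun (F i)) -> polyfun (fun t => \sum_i F i t).
Proof.
move=> HF; have [p Hp] := choice HF.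
by exists (\sum_i p i) => t; rewrite horner_sum; apply: eq_bigr => i _.
Qed.

Lemma polyfun_det n (A : k -> 'M[k]_n) :
  (forall i j, polyfun (fun t => A t i j)) -> polyfun (fun t => \det (A t)).
Proof.
move=> HA; apply: polyfun_sum => s; apply: polyfunM; first exact: polyfun_cst.
have [p Hp] := choice (fun i => HA i (s i)).
by exists (\prod_i p i) => t; rewrite horner_prod; apply: eq_bigr => i _.
Qed.

Lemma polyfun_adj n (A : k -> 'M[k]_n) :
  (forall i j, polyfun (fun t => A t i j)) ->
  forall i j, polyfun (fun t => (\adj (A t)) i j).
Proof.
move=> HA i j; under eq_fun do rewrite mxE /cofactor.
apply: polyfunM; first exact: polyfun_cst.
by apply: polyfun_det => a b; under eq_fun do rewrite !mxE.
Qed.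

Lemma polyfun_mulmx m n p (A : k -> 'M[k]_(m, n)) (B : k -> 'M[k]_(n, p)) :
  (forall i j, polyfun (fun t => A t i j)) ->
  (forall i j, polyfun (fun t => B t i j)) ->
  forall i j, polyfun (fun t => (A t *m B t) i j).
Proof.
move=> HA HB i j; under eq_fun do rewrite mxE.
by apply: polyfun_sum => l; apply: polyfunM.
Qed.

(** The product of the two polynomials is nonzero, hence has finitely many roots. *)
Lemma polyfun_common_nonroot f g s t :
  infinite_set [set: k]%classic -> polyfun f -> polyfun g ->
  f s != 0 -> g t != 0 -> exists u, f u != 0 /\ g u != 0.
Proof.
move=> kinf [p Hp] [q Hq]; rewrite Hp Hq => ps qt.
have pq0 : p * q != 0.
  by rewrite mulf_neq0 //; [apply: contraNneq ps | apply: contraNneq qt] => ->;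
    rewrite horner0.
have [B _ sB] := infinite_set_fset (size (p * q)) kinf.
have : ~~ all (root (p * q)) (finmap.enum_fset B).
  apply/negP => rB; have := max_poly_roots pq0 rB (finmap.fset_uniq B).
  by rewrite ltnNge sB.
by case/allPn => u _; rewrite rootM negb_or !rootE -Hp -Hq => /andP[]; exists u.
Qed.

Lemma polycurve_comp V W (L : V -> W) (c : k -> V) :
  linear L -> polycurve c -> polycurve (L \o c).
Proof. by move=> HL Hc l Hl; apply: (Hc (l \o L)) => a x y /=; rewrite HL Hl. Qed.

Lemma polycurve_line V (x y : V) : polycurve (fun t => x + t *: y).
Proof.
move=> l Hl; apply: (@eq_polyfun _ (fun t => t * l y + l x)).
  by move=> t /=; rewrite addrC Hl.
apply: polyfunD; last exact: polyfun_cst.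
by apply: polyfunM; [apply: polyfun_id | apply: polyfun_cst].
Qed.

End PolynomialCurves.

(** * Families of linear maps depending polynomially on a parameter *)

Definition linmx (k : fieldType) (V W : vectType k) (L : V -> W) :
  'M[k]_(dim V, dim W) := lin1_mx (v2r \o L \o r2v).

(** Polynomial dependence is required vector by vector, which suits operators
    such as composition with a polynomial curve of morphisms. *)
Definition polyop (k : fieldType) (V W : vectType k) (L : k -> V -> W) : Prop :=
  (forall t, linear (L t)) /\ (forall v, polycurve (fun t => L t v)).

Section PolynomialOperators.
Context {k : fieldType}.
Implicit Types V W : vectType k.

Lemma linmxP V W (L : V -> W) v : linear L -> v2r (L v) = v2r v *m linmx L.
Proof.
move=> HL; pose isL := GRing.isLinear.Build k V W _ L HL.
pose L' : {linear V -> W} := HB.pack L isL.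
by have := mul_rV_lin1 (v2r \o L' \o r2v) (v2r v); rewrite /= v2rK => <-.
Qed.

Lemma polycurve_coordP V (c : k -> V) :
  polycurve c <-> forall j, polyfun (fun t => v2r (c t) 0 j).
Proof.
split=> [Hc j|Hc l Hl].
  by apply: (Hc (fun v => v2r v 0 j)) => a x y; rewrite linearP !mxE.
pose isL := GRing.isLinear.Build k V k^o _ l Hl.
pose l' : {linear V -> k^o} := HB.pack l isL.
apply: (@eq_polyfun _ _ (fun t => \sum_j v2r (c t) 0 j * l (r2v (delta_mx 0 j)))).
  move=> t /=; rewrite -[in LHS](v2rK (c t)) [v2r (c t) in LHS]row_sum_delta.
  rewrite linear_sum -[l]/(l' : V -> _) linear_sum; apply: eq_bigr => j _.
  by rewrite !linearZ.
by apply: polyfun_sum => j; apply: polyfunM => //; apply: polyfun_cst.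
Qed.

Lemma polyfun_linmx V W (L : k -> V -> W) :
  polyop L -> forall i j, polyfun (fun t => linmx (L t) i j).
Proof.
move=> [_ HL] i j; under eq_fun do rewrite mxE /=.
by have /polycurve_coordP := HL (r2v (delta_mx 0 i)); exact.
Qed.

(** A solution of [L 0 v = 0] deforms polynomially when [L 0] is surjective.  In
    row-vector coordinates, let [D t] be the matrix of [L t] and [S] that of a section of
    [L 0], so that the square matrix [S D(t)] is 1 at [t = 0].  Where it is invertible,
    [(S D(t))^-1 S] is a section of [L t], and subtracting from [m0] the image of
    [L t m0] under it gives a vector of the kernel.  Multiplying by [det (S D(t))]
    clears the denominators and turns the inverse into an adjugate. *)
Lemma polycurve_kernel V W (L : k -> V -> W) m0 :
  polyop L -> (forall w, exists v, L 0 v = w) -> L 0 m0 = 0 ->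
  exists c : k -> V, [/\ polycurve c, c 0 = m0 & forall t, L t (c t) = 0].
Proof.
move=> polyL surjL Lm0; have [linL _] := polyL.
pose D t := linmx (L t); have polyD := polyfun_linmx polyL.
have [s Ls] := choice surjL.
pose S : 'M[k]_(dim W, dim V) := \matrix_(i < dim W) v2r (s (r2v (row i 1%:M))).
have SD0 : S *m D 0 = 1%:M.
  by apply/row_matrixP => i; rewrite row_mul rowK -linmxP // Ls r2vK.
have polyS i j : polyfun (fun _ : k => S i j) by apply: polyfun_cst.
have polySD := polyfun_mulmx polyS polyD.
pose u t : 'rV[k]_(dim V) :=
  \det (S *m D t) *: v2r m0 - v2r m0 *m D t *m \adj (S *m D t) *m S.
have m0D : v2r m0 *m D 0 = 0 by rewrite -linmxP // Lm0 linear0.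
exists (r2v \o u); split.
- apply/polycurve_coordP => j.
  under eq_fun do rewrite r2vK /u mxE [X in X + _]mxE [X in _ + X]mxE.
  apply: polyfunD.
    by apply: polyfunM; [apply: polyfun_det | apply: polyfun_cst].
  apply: (@eq_polyfun _ _
    (fun t => -1 * (v2r m0 *m D t *m \adj (S *m D t) *m S) 0 j)).
    by move=> t; rewrite mulN1r.
  apply: polyfunM; first exact: polyfun_cst.
  apply: polyfun_mulmx => //; apply: polyfun_mulmx; last exact: polyfun_adj.
  by apply: polyfun_mulmx => // *; apply: polyfun_cst.
- by rewrite /= /u m0D SD0 det1 scale1r !mul0mx subr0 v2rK.
move=> t; apply: v2r_inj; rewrite linear0 linmxP //= r2vK mulmxBl -scalemxAl.
by rewrite -!mulmxA mul_adj_mx mulmxA mul_mx_scalar subrr.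
Qed.

(** The exceptional parameters are the zeros of a determinant. *)
Lemma polyop_generic_bij V (L : k -> V -> V) t0 :
  polyop L -> L t0 =1 id ->
  exists d : k -> k, [/\ polyfun d, d t0 != 0
    & forall t, d t != 0 -> bijective (L t)].
Proof.
move=> polyL L0; have [linL _] := polyL.
exists (fun t => \det (linmx (L t))); split.
- exact/polyfun_det/polyfun_linmx.
- suff -> : linmx (L t0) = 1%:M by rewrite det1 oner_neq0.
  apply/row_matrixP => i; rewrite rowE -[delta_mx _ _]r2vK -linmxP // L0 r2vK.
  by rewrite row1.
move=> t dt; have unitD : linmx (L t) \in unitmx by rewrite unitmxE unitfE.
exists (fun v => r2v (v2r v *m invmx (linmx (L t)))) => v.
  by rewrite linmxP // mulmxK // v2rK.
by apply: v2r_inj; rewrite linmxP // r2vK mulmxKV.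
Qed.

End PolynomialOperators.

(** * Linear and triangulated categories *)

Section LinearCategory.
Context {k : fieldType} {C D : hfcat k}.
Implicit Types X Y Z : C.

HB.instance Definition _ X Y Z (g : hom Y Z) :=
  GRing.isLinear.Build k (hom X Y) (hom X Z) *:%R (comp g)
    (fun a f f' => comp_linr a g f f').

HB.instance Definition _ (F : lfunctor C D) X Y :=
  GRing.isLinear.Build k (hom X Y) (hom (fobj F X) (fobj F Y)) *:%R
    (@fmap k C D F X Y) (@fmap_lin k C D F X Y).

Lemma comp_linear_l X Y Z (f : hom X Y) : linear (fun g : hom Y Z => g \c f).
Proof. by move=> a g g'; apply: comp_linl. Qed.

Lemma comp0m X Y Z (f : hom X Y) : (0 : hom Y Z) \c f = 0.
Proof.
by have := comp_linl (-1) (0 : hom Y Z) 0 f; rewrite !scaleN1r oppr0 addr0 addNr.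
Qed.

Lemma compNm X Y Z (g : hom Y Z) (f : hom X Y) : (- g) \c f = - (g \c f).
Proof.
by have := comp_linl (-1) g 0 f; rewrite !scaleN1r comp0m !addr0.
Qed.

Lemma compBm X Y Z (g g' : hom Y Z) (f : hom X Y) :
  (g - g') \c f = g \c f - g' \c f.
Proof. by have := comp_linl (-1) g' g f; rewrite !scaleN1r ![- _ + _]addrC. Qed.

Lemma is_iso_comp X Y Z (g : hom Y Z) (f : hom X Y) :
  is_iso g -> is_iso f -> is_iso (g \c f).
Proof.
move=> [g' [gK g'K]] [f' [fK f'K]]; exists (f' \c g'); split.
  by rewrite -compA (compA g') gK comp1m.
by rewrite -compA (compA f) f'K comp1m.
Qed.

Lemma is_iso_of_compositions X Y (f : hom X Y) (g : hom Y X) :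
  is_iso (g \c f) -> is_iso (f \c g) -> is_iso f.
Proof.
move=> [u [uK _]] [v [_ vK]].
have E : u \c g = g \c v.
  by rewrite -[LHS]compm1 -vK -(compA u) -[in RHS](comp1m g) -uK -!compA.
by exists (u \c g); rewrite -compA uK E compA vK.
Qed.

Lemma is_iso_mono X Y Z (u : hom Y Z) (f g : hom X Y) :
  is_iso u -> u \c f = u \c g -> f = g.
Proof.
by move=> [v [vK _]] E; rewrite -[f]comp1m -[g]comp1m -vK -!compA E.
Qed.

Lemma is_iso_epi X Y Z (u : hom X Y) (f g : hom Y Z) :
  is_iso u -> f \c u = g \c u -> f = g.
Proof.
by move=> [v [_ vK]] E; rewrite -[f]compm1 -[g]compm1 -vK !compA E.
Qed.

(** The preimage [b] of the identity satisfies [a b = 1]; then [a (b a) = a 1], and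
    injectivity gives [b a = 1]. *)
Lemma is_iso_bij_comp X (a : hom X X) :
  bijective (fun x : hom X X => a \c x) -> is_iso a.
Proof.
move=> [b bK aK]; exists (b (idm X)); split; last exact: aK.
by apply: (can_inj bK); rewrite /= compA aK comp1m compm1.
Qed.

(** Left composition with [a t] is a polynomial family of operators on [End(X)], and
    [a t] is invertible as soon as its operator is bijective. *)
Lemma generic_is_iso X (a : k -> hom X X) t0 :
  polycurve a -> a t0 = idm X ->
  exists d : k -> k, [/\ polyfun d, d t0 != 0 & forall t, d t != 0 -> is_iso (a t)].
Proof.
move=> polya a0.
have [||d [polyd d0 dP]] :=
    @polyop_generic_bij _ _ (fun t (x : hom X X) => a t \c x) t0.
- split=> [t c x y|x]; first exact: comp_linr.
  exact: polycurve_comp (comp_linear_l x) polya.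
- by move=> x; rewrite a0 comp1m.
by exists d; split=> // t dt; apply: is_iso_bij_comp (dP t dt).
Qed.

Lemma is_zero_iso X Y : is_zero X -> is_zero Y -> iso X Y.
Proof.
move=> [X0 _] [Y0 _]; exists 0, 0.
by rewrite (X0 _ (idm X)) (Y0 _ (idm Y)) !comp0m.
Qed.

End LinearCategory.

Section TriangulatedCategory.
Context {k : fieldType} {C : tricat k}.
Implicit Types X Y Z : C.
Local Notation T := (tshift C).

Lemma tshift_faithful X Y (f g : hom X Y) : fmap T f = fmap T g -> f = g.
Proof.
move=> E; apply: is_iso_mono (tshift_unit_iso Y) _.
by rewrite -!tshift_unit_nat E.
Qed.

Lemma tshiftV_faithful X Y (f g : hom X Y) :
  fmap (tshiftV C) f = fmap (tshiftV C) g -> f = g.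
Proof.
move=> E; apply: is_iso_epi (tshift_counit_iso X) _.
by rewrite -!tshift_counit_nat E.
Qed.

(** The preimage of [g] is its image under the quasi-inverse, conjugated by the unit. *)
Lemma tshift_full X Y (g : hom (T X) (T Y)) : exists f : hom X Y, fmap T f = g.
Proof.
have [v [vK uK]] := tshift_unit_iso Y.
exists (v \c fmap (tshiftV C) g \c tshift_unit X).
apply: tshiftV_faithful; apply: is_iso_epi (tshift_unit_iso X) _.
by rewrite tshift_unit_nat !compA uK comp1m.
Qed.

Lemma tshift_is_zero X : is_zero X -> is_zero (T X).
Proof.
have fmap0 Y Z : fmap T (0 : hom Y Z) = 0 by exact: raddf0.
move=> X0; have id0 : idm (T X) = 0 by rewrite -fmap_id (X0.1 _ (idm X)) fmap0.
split=> Y f; first by rewrite -[f]compm1 id0 raddf0.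
by rewrite -[f]comp1m id0 comp0m.
Qed.

Lemma tshift_reflects_iso X Y : iso (T X) (T Y) -> iso X Y.
Proof.
move=> [f' [g' [gf fg]]]; have [f Ef] := tshift_full f'.
have [g Eg] := tshift_full g'; exists f, g.
by split; apply: tshift_faithful; rewrite fmap_comp fmap_id Ef Eg.
Qed.

(** The morphism [u] is the third side of a map from the triangle [U -> 0 -> U[1]] to
    the rotation of the given one, moved back along the fully faithful shift. *)
Lemma weak_kernel X Y Z U (f : hom X Y) (g : hom Y Z) (h : hom Z (T X))
    (v : hom U Y) :
  tri f g h -> g \c v = 0 -> exists u : hom U X, v = f \c u.
Proof.
move=> /tri_rot fgh gv; have [N N0] := zero_exists C.
have /tri_rot idU := tri_id U N0.
have [|w [_ E]] := tri_mor (u := v) (v := 0 : hom N Z) idU fgh.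
  by rewrite raddf0 gv.
have [u Eu] := tshift_full w; exists u.
apply: tshift_faithful; rewrite fmap_comp Eu; apply: oppr_inj.
by rewrite -compNm -E fmap_id raddfN /= compm1.
Qed.

Lemma weak_cokernel X Y Z U (f : hom X Y) (g : hom Y Z) (h : hom Z (T X))
    (v : hom Y U) :
  tri f g h -> v \c f = 0 -> exists w : hom Z U, v = w \c g.
Proof.
move=> fgh vf; have [N N0] := zero_exists C.
have idU : tri (0 : hom N U) (idm U) (0 : hom U (T N)).
  apply/tri_rot; have -> : - fmap T (0 : hom N U) = 0 by rewrite raddf0 oppr0.
  exact/tri_id/tshift_is_zero.
have [|w [E _]] := tri_mor (u := 0 : hom X N) (v := v) fgh idU.
  by rewrite vf raddf0.
by exists w; rewrite E comp1m.
Qed.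

(** The composites of the two comparison maps between the cones are endomorphisms
    [1 + n] acting trivially on both sides, and such an [n] has square zero. *)
Lemma iso_cones X Y Z X' Y' Z' (f : hom X Y) (g : hom Y Z) (h : hom Z (T X))
    (f' : hom X' Y') (g' : hom Y' Z') (h' : hom Z' (T X'))
    (u : hom X X') (v : hom Y Y') :
  tri f g h -> tri f' g' h' -> is_iso u -> is_iso v -> v \c f = f' \c u ->
  iso Z Z'.
Proof.
have unip X1 Y1 Z1 (f1 : hom X1 Y1) (g1 : hom Y1 Z1) h1 (e : hom Z1 Z1) :
    tri f1 g1 h1 -> e \c g1 = g1 -> h1 \c e = h1 -> is_iso e.
  move=> fgh eg he.
  pose n := e - idm Z1.
  have [y Ey] : exists y, n = y \c h1.
    apply: weak_cokernel (iffLR (tri_rot _ _ _) fgh) _.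
    by rewrite compBm eg comp1m subrr.
  have en : e \c n = n.
    apply: subr0_eq; rewrite -{2}[n]comp1m -compBm -/n {1}Ey -compA raddfB /=.
    by rewrite he compm1 subrr raddf0.
  have ne : n \c e = n by rewrite -{2}en raddfB compBm /= comp1m compm1.
  exists (idm Z1 - n); split.
    by rewrite compBm ne comp1m /n opprB addrC subrK.
  by rewrite raddfB /= en compm1 /n opprB addrC subrK.
move=> fgh fgh' [u' [uK u'K]] [v' [vK v'K]] E.
have E' : v' \c f' = f \c u'.
  by rewrite -[f']compm1 -u'K (compA f') -E !compA vK comp1m.
have [w [wg hw]] := tri_mor fgh fgh' E.
have [w' [wg' hw']] := tri_mor fgh' fgh E'.
exists w; apply: (@is_iso_of_compositions _ _ _ _ w w').
- apply: unip fgh _ _; first by rewrite -compA wg compA wg' -compA vK compm1.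
  by rewrite compA -hw' -compA -hw compA -fmap_comp uK fmap_id comp1m.
- apply: unip fgh' _ _; first by rewrite -compA wg' compA wg -compA v'K compm1.
  by rewrite compA -hw -compA -hw' compA -fmap_comp u'K fmap_id comp1m.
Qed.

End TriangulatedCategory.

(** * Rigid objects and their filtrations *)

Definition rigid (k : fieldType) (C : tricat k) (X : C) : Prop :=
  forall f : hom X (tshift C X), f = 0.

Section RigidExtensions.
Context {k : fieldType} {C : tricat k}.
Implicit Types A B E X Y : C.
Local Notation T := (tshift C).

Lemma spherical_rigid X : spherical X -> rigid X.
Proof.
move=> /(_ 1) /eqP; rewrite dimv_eq0 => /eqP E f.
by apply/eqP; rewrite -memv0 -[0%VS]E memvf.
Qed.

(** By duality every linear form on [Hom(B, A[2])] vanishes, in particular the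
    coordinate forms. *)
Lemma serre_vanishing A B :
  is_2CY C -> (forall f : hom A B, f = 0) -> forall g : hom B (T (T A)), g = 0.
Proof.
move=> [kappa [_ bij _ _]] AB0 g; have [r _ rK] := bij A B.
pose H : vectType k := hom B (shiftz A 2%:Z).
have form0 (l : 'Hom(H, k^o)) : l = 0.
  by rewrite -(rK l) (AB0 (r l)) -(AB0 (r 0)) rK.
apply: (@v2r_inj _ H); rewrite linear0; apply/rowP => j; rewrite mxE.
pose c (v : H) : k^o := v2r v 0 j.
have c_lin : linear c by move=> a x y; rewrite /c linearP !mxE.
pose c' : {linear H -> k^o} := HB.pack c (GRing.isLinear.Build k H k^o _ c c_lin).
by have := lfunE c' g; rewrite (form0 (linfun c')) lfunE => /esym.
Qed.

(** A morphism [u : A -> A[1]] extends along [A -> E] because the obstruction lies in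
    [Hom(B, A[2])], dual to [Hom(A, B) = 0].  The extension dies in [Hom(E, E[1]) = 0],
    hence factors as [E -> B -> A[1]], and [A -> E -> B] is zero. *)
Lemma mukai_rigid_sub A E B (i : hom A E) (p : hom E B) (h : hom B (T A)) :
  is_2CY C -> tri i p h -> (forall f : hom A B, f = 0) -> rigid E -> rigid A.
Proof.
move=> CY /tri_rot ABE AB0 rigE u; have hip := iffLR (tri_rot _ _ _) ABE.
have [w Ew] := weak_cokernel hip (serre_vanishing CY AB0 (fmap T u \c h)).
have [u' Eu'] := tshift_full w.
have {Ew} -> : u = - u' \c i.
  by apply: tshift_faithful; rewrite Ew -Eu' compNm raddfN /= !raddfN /= fmap_comp.
have [|v ->] := weak_kernel (v := u') hip.
  by rewrite compNm (rigE (_ \c u')) oppr0.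
by rewrite compNm -compA (AB0 (v \c i)) raddf0 oppr0.
Qed.

(** This is the surjectivity of the differential at [h] of the orbit map of
    [Aut(A[1]) x Aut(B)]: rigid extensions have an open orbit.  The composite
    [E -> B -> A[1] -> E[1]] through [w] is zero, so [w p] factors as [h v] with
    [v : E -> B].  As [Hom(A, B) = 0], [v] is [b p] for some [b : B -> B]; then [w - h b]
    kills [p] and factors through [h]. *)
Lemma rigid_extension_orbit A E B (i : hom A E) (p : hom E B) (h : hom B (T A)) :
  tri i p h -> (forall f : hom A B, f = 0) -> rigid E ->
  forall w : hom B (T A),
    exists v : (hom (T A) (T A) * hom B B)%type, v.1 \c h - h \c v.2 = w.
Proof.
move=> ABE AB0 rigE w.
have phi := iffLR (tri_rot _ _ _) ABE; have hip := iffLR (tri_rot _ _ _) phi.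
have [|v Ev] := weak_kernel (v := w \c p) hip.
  by rewrite compNm (rigE (_ \c (w \c p))) oppr0.
have [b Eb] := weak_cokernel ABE (AB0 (v \c i)).
have [|a Ea] := weak_cokernel (v := w - h \c b) phi.
  by rewrite compBm Ev Eb compA subrr.
by exists (a, - b); rewrite /= -Ea raddfN opprK subrK.
Qed.

(** The surjectivity at [t = 0] of [(a, b) |-> a h - (h + t (h' - h)) b] deforms the
    solution [(1, 1)], which stays invertible for all but finitely many [t]. *)
Lemma generic_extension_iso A E B (i : hom A E) (p : hom E B) (h h' : hom B (T A)) :
  tri i p h -> (forall f : hom A B, f = 0) -> rigid E ->
  exists d : k -> k, [/\ polyfun d, d 0 != 0 & forall t, d t != 0 ->
    exists (a : hom (T A) (T A)) (b : hom B B),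
      [/\ is_iso a, is_iso b & a \c h = (h + t *: (h' - h)) \c b]].
Proof.
move=> ABE AB0 rigE.
pose V : vectType k := (hom (T A) (T A) * hom B B)%type.
pose L t (v : V) := v.1 \c h - (h + t *: (h' - h)) \c v.2.
have polyL : polyop L.
  split=> [t c [x y] [x' y']|v].
    rewrite /L /= comp_linl comp_linr opprD addrACA.
    by rewrite !scalerBr.
  have -> : L^~ v = fun t => (v.1 \c h - h \c v.2) + t *: ((h - h') \c v.2).
    apply/funext => t; rewrite /L -[h - h']opprB compNm scalerN [h + _]addrC.
    by rewrite comp_linl opprD [- (t *: _) + _]addrC addrA.
  exact: polycurve_line.
have L0 (v : V) : L 0 v = v.1 \c h - h \c v.2 by rewrite /L scale0r addr0.
have [w||c [polyc c0 Lc]] :=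
  polycurve_kernel (m0 := (idm (T A), idm B) : V) polyL.
- by have [v Ev] := rigid_extension_orbit ABE AB0 rigE w; exists v; rewrite L0.
- by rewrite L0 comp1m compm1 subrr.
have poly1 : polycurve (fun t => (c t).1).
  by apply: (@polycurve_comp _ _ _ fst) polyc => x y z.
have poly2 : polycurve (fun t => (c t).2).
  by apply: (@polycurve_comp _ _ _ snd) polyc => x y z.
have [|d1 [pd1 d10 iso1]] := generic_is_iso (t0 := 0) poly1; first by rewrite c0.
have [|d2 [pd2 d20 iso2]] := generic_is_iso (t0 := 0) poly2; first by rewrite c0.
exists (fun t => d1 t * d2 t); split; [exact: polyfunM | exact: mulf_neq0 |].
move=> t; rewrite mulf_eq0 negb_or => /andP[d1t d2t].
exists (c t).1, (c t).2; split; [exact: iso1 | exact: iso2 |].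
exact/subr0_eq/Lc.
Qed.

(** On the line through the two extension classes, all but finitely many points lie
    in the orbit of the first one, and likewise for the second one; over an infinite
    field some point lies in both. *)
Lemma rigid_extension_unique A B E E' (i : hom A E) (p : hom E B) (h : hom B (T A))
    (i' : hom A E') (p' : hom E' B) (h' : hom B (T A)) :
  infinite_set [set: k]%classic -> (forall f : hom A B, f = 0) ->
  tri i p h -> tri i' p' h' -> rigid E -> rigid E' -> iso E E'.
Proof.
move=> kinf AB0 ABE ABE' rigE rigE'.
have [d [polyd d0 dP]] := generic_extension_iso h' ABE AB0 rigE.
have [d' [polyd' d'0 d'P]] := generic_extension_iso h ABE' AB0 rigE'.
(* Seen from [h'], the line is run backwards: its parameter there is [1 - t]. *)
have poly1B : polyfun (fun t : k => 1 - t).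
  by exists (1 - 'X) => t; rewrite hornerD hornerN hornerX hornerC.
have [|t [dt d't]] := polyfun_common_nonroot (t := 1) kinf polyd
  (polyfun_comp polyd' poly1B) d0; first by rewrite /= subrr.
have [a [b [isoa isob E1]]] := dP _ dt.
have [a' [b' [[a'V [a'K Ka']] [b'V [b'K Kb']] E2]]] := d'P _ d't.
have Eh : h' + (1 - t) *: (h - h') = h + t *: (h' - h).
  by rewrite scalerBl scale1r addrA subrKC -scalerN opprB.
rewrite Eh in E2.
have Eab : (a'V \c a) \c h = h' \c (b'V \c b).
  rewrite -compA E1 -[b in LHS]comp1m -Kb' -compA (compA _ b') -E2 !compA a'K.
  by rewrite comp1m.
have tE := iffLR (tri_rot _ _ _) (iffLR (tri_rot _ _ _) ABE).
have tE' := iffLR (tri_rot _ _ _) (iffLR (tri_rot _ _ _) ABE').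
apply: tshift_reflects_iso; apply: iso_cones tE tE' _ _ (Eab).
  by apply: is_iso_comp isob; exists b'.
by apply: is_iso_comp isoa; exists a'.
Qed.

(** Along an isomorphism [Y -> Y'], an extension of [B] by [Y'] becomes an extension
    of [B] by [Y], so that the extension classes can be compared. *)
Lemma rigid_extension_unique_iso Y Y' B E E' (i : hom Y E) (p : hom E B)
    (h : hom B (T Y)) (i' : hom Y' E') (p' : hom E' B) (h' : hom B (T Y')) :
  infinite_set [set: k]%classic -> (forall f : hom Y B, f = 0) -> iso Y Y' ->
  tri i p h -> tri i' p' h' -> rigid E -> rigid E' -> iso E E'.
Proof.
move=> kinf YB0 [u [v [vK uK]]] t1 t2.
apply: rigid_extension_unique kinf YB0 t1 _.
have id_iso X : is_iso (idm X) by exists (idm X); rewrite comp1m.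
apply: (tri_iso (f' := i' \c u) (g' := p') (h' := fmap T v \c h')
  (u := v) _ (id_iso _) (id_iso _)) t2; first by exists u.
- by rewrite comp1m -compA uK compm1.
- by rewrite comp1m compm1.
- by rewrite compm1.
Qed.

End RigidExtensions.

Section FilteredRigid.
Context {k : fieldType} {C : tricat k}.
Local Notation T := (tshift C).

Definition is_extension (Y E B : C) : Prop :=
  exists (f : hom Y E) (g : hom E B) (h : hom B (T Y)), tri f g h.

(** [Hom(-, B)] is exact in the middle of each triangle of the filtration. *)
Lemma hom_filtered_eq0 (Fil A : nat -> C) (B : C) n :
  is_zero (Fil 0%N) -> (forall i, (i < n)%N -> is_extension (Fil i) (Fil i.+1) (A i)) ->
  (forall i, (i < n)%N -> forall f : hom (A i) B, f = 0) ->
  forall f : hom (Fil n) B, f = 0.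
Proof.
move=> F0; elim: n => [|n IH] ext AB0 f; first exact: F0.1.
have [i [p [h t]]] := ext _ (ltnSn n).
have fi : f \c i = 0 by apply: IH => j /ltnW //; [apply: ext | apply: AB0].
by have [g ->] := weak_cokernel t fi; rewrite (AB0 n _ g) ?comp0m.
Qed.

(** Rigidity descends to the truncations of the filtrations, which are therefore
    isomorphic by induction; the last step compares two rigid extensions. *)
Lemma filtered_rigid_unique (Fil Fil' A : nat -> C) n :
  infinite_set [set: k]%classic -> is_2CY C ->
  is_zero (Fil 0%N) -> is_zero (Fil' 0%N) ->
  (forall i, (i < n)%N -> is_extension (Fil i) (Fil i.+1) (A i)) ->
  (forall i, (i < n)%N -> is_extension (Fil' i) (Fil' i.+1) (A i)) ->
  (forall i j, (i < j)%N -> (j < n)%N -> forall f : hom (A i) (A j), f = 0) ->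
  rigid (Fil n) -> rigid (Fil' n) -> iso (Fil n) (Fil' n).
Proof.
move=> kinf CY F0 F'0; elim: n => [|n IH] ext ext' A0 rigF rigF'.
  exact: is_zero_iso.
have ext_n i (lt_in : (i < n)%N) := ext i (ltnW lt_in).
have ext'_n i (lt_in : (i < n)%N) := ext' i (ltnW lt_in).
have A0n i (lt_in : (i < n)%N) := A0 i n lt_in (ltnSn n).
have FA0 := hom_filtered_eq0 F0 ext_n A0n.
have F'A0 := hom_filtered_eq0 F'0 ext'_n A0n.
have [f [g [h t]]] := ext n (ltnSn n).
have [f' [g' [h' t']]] := ext' n (ltnSn n).
apply: (rigid_extension_unique_iso kinf FA0 _ t t' rigF rigF').
apply: IH => //.
- by move=> i j lt_ij lt_jn; apply: A0 => //; apply: ltnW.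
- exact: mukai_rigid_sub CY t FA0 rigF.
- exact: mukai_rigid_sub CY t' F'A0 rigF'.
Qed.

(** Indexing by natural numbers keeps the types fixed when a filtration is truncated. *)
Lemma HN_filtrationP (R : realType) (tau : stability_condition R C) (X : C)
    (n : nat) (A : 'I_n.+1 -> C) :
  HN_filtration (slice tau) X A ->
  exists Fil : nat -> C, [/\ is_zero (Fil 0%N), Fil n.+1 = X,
    forall i, (i < n.+1)%N -> is_extension (Fil i) (Fil i.+1) (A (inord i))
  & forall i j, (i < j)%N -> (j < n.+1)%N ->
      forall f : hom (A (inord i)) (A (inord j)), f = 0].
Proof.
move=> [Fil [phi [F0 FX ext ss dec]]]; exists (fun i => Fil (inord i)).
split.
- by have -> : inord 0 = ord0 :> 'I_n.+2 by apply/val_inj; rewrite /= inordK.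
- by rewrite -FX; congr Fil; apply/val_inj; rewrite /= inordK.
- move=> i lt_in; have := ext (inord i).
  have -> : widen_ord (leqnSn n.+1) (inord i) = inord i.
    by apply/val_inj; rewrite /= !inordK // ltnW.
  have -> // : lift ord0 (inord i : 'I_n.+1) = inord i.+1.
  by apply/val_inj; rewrite /= /bump !inordK.
move=> i j lt_ij lt_jn.
apply: slice_hom (ss _).1 (ss _).1.
by apply: dec; rewrite !inordK // (ltn_trans lt_ij).
Qed.

End FilteredRigid.

Theorem theorem8p6 (R : realType) (k : fieldType)
  (k_infinite : infinite_set [set: k]%classic)
  (C : tricat k) (C_2CY : is_2CY C) (C_dg : has_dg_enhancement C)
  (tau : stability_condition R C)
  (spherical_stable : forall (phi : R) (S : C),
     spherical S -> semistable tau phi S -> stable tau phi S)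
  (X W : C) (X_spherical : spherical X) (W_spherical : spherical W)
  (n : nat) (A : 'I_n.+1 -> C)
  (X_HN : HN_filtration (slice tau) X A)
  (W_HN : HN_filtration (slice tau) W A) :
  iso X W.
Proof.
have [F [F0 FX extF A0]] := HN_filtrationP X_HN.
have [G [G0 GW extG _]] := HN_filtrationP W_HN.
rewrite -FX -GW; apply: filtered_rigid_unique (extF) (extG) A0 _ _ => //.
  by rewrite FX; apply: spherical_rigid.
by rewrite GW; apply: spherical_rigid.
Qed.
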